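(* Let $\nu\ge 0$ and $\alpha>-1$, and let $(P_n)_{n\in\mathbb{N}_0}$ be a sequence of real polynomials. The orthogonality conditions $$\int_0^\infty P_n(x)P_m(x)\,x^\alpha\rho_\nu(x)\,dx=\delta_{n,m},\qquad n,m\in\mathbb{N}_0,$$ hold if and only if the composition orthogonality conditions (composition orthogonality in the sense of Laguerre) $$\int_0^\infty t^\nu e^{-t}\,P_m(\theta)P_n(\theta)\{t^\alpha\}\,dt=\frac{\delta_{m,n}}{\Gamma(1+\alpha)},\qquad m,n\in\mathbb{N}_0,$$ hold. In other words, Prudnikov's orthogonal polynomials are exactly the polynomials that are compositionally orthogonal in the sense of Laguerre.
   Context: For $\nu\in\mathbb{R}$ and $x>0$, $\rho_\nu(x)=2x^{\nu/2}K_\nu(2\sqrt{x})$, where $K_\nu$ is the modified Bessel function of the second kind; equivalently $\rho_\nu(x)=\int_0^\infty t^{\nu-1}e^{-t-x/t}\,dt$. The differential operator $\theta$ is defined by $\theta=tDt$, i.e. $(\theta f)(t)=t\frac{d}{dt}\big(tf(t)\big)$. For a polynomial $P(x)=\sum_k p_kx^k$, $P(\theta)$ denotes the operator $\sum_k p_k\theta^k$, and $P_m(\theta)P_n(\theta)$ denotes the composition of these operators. Note that $\theta^j\{t^\alpha\}=(1+\alpha)_j\,t^{\alpha+j}$. Here $\delta_{n,m}$ is the Kronecker delta. *)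

(* Defs.v *)
From HB Require Import structures.
From mathcomp Require Import all_boot all_order all_algebra.
From mathcomp Require Import all_classical all_reals all_analysis.
Set Implicit Arguments. Unset Strict Implicit. Unset Printing Implicit Defensive.
Import Order.TTheory GRing.Theory Num.Theory.
Local Open Scope classical_set_scope.
Local Open Scope ring_scope.

Section Defs.
Variable R : realType.

Definition rho (nu x : R) : R :=
  Rintegral (@lebesgue_measure R) `]0, +oo[
    (fun t : R => t `^ (nu - 1) * expR (- t - x / t)).

Definition Gamma (s : R) : R :=
  Rintegral (@lebesgue_measure R) `]0, +oo[
    (fun t : R => t `^ (s - 1) * expR (- t)).

Definition theta (f : R -> R) : R -> R :=
  fun t => t * derive1 (fun s : R => s * f s) t.

Definition polyop (p : {poly R}) (f : R -> R) : R -> R :=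
  fun t => \sum_(k < size p) p`_k * iter k theta f t.

End Defs.

(* Main.v *)
Require Import Defs.
From HB Require Import structures.
From mathcomp Require Import all_boot all_order all_algebra.
From mathcomp Require Import all_classical all_reals all_analysis.
From mathcomp Require Import measurable_realfun ring lra.
Import Order.TTheory GRing.Theory Num.Theory.
Import numFieldNormedType.Exports.
Local Open Scope classical_set_scope.
Local Open Scope ring_scope.

(** By Tonelli, the moments of [rho nu] factor as
    [\int x^(s-1) rho nu x dx = Gamma s * Gamma (nu + s)].  On the other side
    [theta^k t^alpha = (1 + alpha)_k t^(alpha + k)] on the half-line, so that
    [\int t^nu e^(-t) theta^k t^alpha dt] equals
    [(1 + alpha)_k Gamma (nu + alpha + 1 + k)].  Since
    [Gamma (1 + alpha + k) = (1 + alpha)_k Gamma (1 + alpha)], the two bilinear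
    forms differ by the constant positive factor [Gamma (1 + alpha)]. *)

(** * Scaling, Tonelli's theorem on products, and two elementary integrals *)

Section integration.
Context {R : realType}.
Local Notation mu := (@lebesgue_measure R).
Local Open Scope ereal_scope.

(** By uniqueness of Lebesgue measure: [c] times the pushforward under multiplication by [c] gives
    each interval []a, b]] its length. *)
Lemma lebesgue_measure_scale (c : R) (A : set R) : (0 < c)%R -> measurable A ->
  mu A = c%:E * mu ( *%R c @^-1` A).
Proof.
move=> c0 mA.
have mc : measurable_fun setT ( *%R c : R -> measurableTypeR R) by [].
pose m_ := mscale (NngNum (ltW c0)) (pushforward mu ( *%R c : R -> measurableTypeR R)).
pose m := m_ mc.
have pre (a b : R) : *%R c @^-1` `]a, b] = `](c^-1 * a)%R, (c^-1 * b)%R]%classic.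
  apply/seteqP; split => x /=; rewrite !in_itv/=;
  by rewrite ltr_pdivrMl// ler_pdivlMl.
rewrite -[RHS]/(m A); apply: lebesgue_measure_unique => // _ [[a b] _ <-].
rewrite -[RHS]/(c%:E * mu ( *%R c @^-1` `]a, b])) pre.
rewrite !lebesgue_measure_itv/= !lte_fin ltr_pM2l ?invr_gt0//.
case: ifPn => ab; last by rewrite mule0.
by rewrite -!EFinD -EFinM -mulrBr mulVKf// gt_eqF.
Qed.

(** The substitution [x = c * y]: the half-line is its own preimage under multiplication by [c], so
    only the measure changes. *)
Lemma ge0_integral_scale (c : R) (f : R -> R) : (0 < c)%R ->
  measurable_fun setT f -> (forall x, 0 < x -> 0 <= f x)%R ->
  \int[mu]_(x in `]0%R, +oo[) (f x)%:E =
  c%:E * \int[mu]_(x in `]0%R, +oo[) (f (c * x)%R)%:E.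
Proof.
move=> c0 mf f0.
have mc : measurable_fun setT ( *%R c : R -> measurableTypeR R) by [].
have pos (x : measurableTypeR R) : `]0%R, +oo[%classic x -> 0 <= (f x)%:E.
  by move=> /=; rewrite in_itv/= andbT lee_fin => /f0.
have mf0 : measurable_fun (`]0%R, +oo[ : set R) (EFin \o f).
  by apply/measurable_EFinP; apply: measurable_funTS.
pose m_ := mscale (NngNum (ltW c0)) (pushforward mu ( *%R c : R -> measurableTypeR R)).
pose m := m_ mc.
transitivity (\int[m]_(x in `]0%R, +oo[) (f x)%:E).
  apply: eq_measure_integral => A mA _.
  exact: lebesgue_measure_scale.
rewrite /m /m_ ge0_integral_mscale//=; congr (_ * _).
rewrite ge0_integral_pushforward//=; last by move=> y /set_mem; exact: pos.
congr (integral _ _ _); apply/seteqP; split => x /=; rewrite !in_itv/= !andbT.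
  by rewrite pmulr_rgt0.
by rewrite pmulr_rgt0.
Qed.

(** Extending [f] by zero outside [D] x [E] reduces the claim to Tonelli on the whole plane. *)
Lemma tonelli_setX (D E : set R) (f : R -> R -> R) :
  measurable D -> measurable E ->
  measurable_fun (D `*` E) (fun z => f z.1 z.2) ->
  (forall x y, D x -> E y -> 0 <= f x y)%R ->
  \int[mu]_(x in D) \int[mu]_(y in E) (f x y)%:E =
  \int[mu]_(y in E) \int[mu]_(x in D) (f x y)%:E.
Proof.
move=> mD mE mf f0.
have mDE : measurable (D `*` E) by exact: measurableX.
pose g := (fun z : R * R => (f z.1 z.2)%:E) \_ (D `*` E).
have mg : measurable_fun setT g.
  by apply/(measurable_restrictT _ mDE); apply/measurable_EFinP.
have g0 z : 0 <= g z.
  rewrite /g patchE; case: ifPn => // /set_mem[? ?]; rewrite lee_fin; exact: f0.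
transitivity (\int[mu]_x \int[mu]_y g (x, y)).
  rewrite integral_mkcond; apply: eq_integral => x _.
  rewrite patchE; case: ifPn => xD.
    rewrite integral_mkcond; apply: eq_integral => y _.
    rewrite /g !patchE; case: ifPn => yE; last first.
      by rewrite ifN// notin_setE => -[] _ /= /mem_set; apply/negP.
    by rewrite ifT//; apply/mem_set; split => /=; exact: set_mem.
  rewrite integral0_eq// => y _; rewrite /g patchE ifN//.
  by rewrite notin_setE => -[] /mem_set + _; apply/negP.
have -> := @fubini_tonelli _ _ (measurableTypeR R) (measurableTypeR R) R mu mu g mg g0.
apply/esym; rewrite integral_mkcond; apply: eq_integral => y _.
rewrite patchE; case: ifPn => yE.
  rewrite integral_mkcond; apply: eq_integral => x _.
  rewrite /g !patchE; case: ifPn => xD; last first.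
    by rewrite ifN// notin_setE => -[] /mem_set + _; apply/negP.
  by rewrite ifT//; apply/mem_set; split => /=; exact: set_mem.
rewrite integral0_eq// => x _; rewrite /g patchE ifN//.
by rewrite notin_setE => -[] _ /= /mem_set; apply/negP.
Qed.

Lemma integral_expRNM (c u : R) : (0 < c)%R ->
  \int[mu]_(t in `]u, +oo[) (c * expR (- (c * t)))%:E = (expR (- (c * u)))%:E.
Proof.
move=> c0.
have ce (a : R) : continuous (fun t : R => a * expR (- (c * t)))%R.
  move=> t; apply: cvgM; first exact: cvg_cst.
  apply: continuous_comp; last exact: continuous_expR.
  by apply: continuousN; apply: cvgM; [exact: cvg_cst|exact: cvg_id].
rewrite integral_itv_obnd_cbnd; last first.
  by apply/measurable_EFinP; apply: measurable_funTS; exact: continuous_measurable_fun.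
rewrite (@ge0_continuous_FTC2y _ _ (fun t => -1 * expR (- (c * t)))%R _ 0%R).
- by rewrite mulN1r EFinN oppeK add0e.
- by move=> x _; rewrite mulr_ge0 ?expR_ge0// ltW.
- exact/continuous_subspaceT/ce.
- rewrite -(mulr0 (-1)%R); apply: cvgM; first exact: cvg_cst.
  apply: (@cvg_comp _ _ _ _ (fun t => expR (- t))%R _ (pinfty_nbhs R)); last exact: cvgr_expR.
  exact: gt0_cvgMry.
- by move=> x _; exact: ex_derive.
- by apply: cvg_at_right_filter; exact: ce.
- move=> x _; rewrite derive1E derive_val /GRing.scale/=. ring.
Qed.

Lemma continuous_powR (p x : R) : (0 < x)%R ->
  {for x, continuous (@powR R ^~ p)}.
Proof.
move=> x0; apply/differentiable_continuous/derivable1_diffP.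
by apply: derivable_powR; rewrite in_itv/= x0.
Qed.

(** For [s < 1] the integrand blows up at 0, so the fundamental theorem is applied on [[a n, t]]
    with [a n] tending to 0, followed by monotone convergence. *)
Lemma integral_powR (s t : R) : (0 < s)%R -> (0 < t)%R ->
  \int[mu]_(u in `]0%R, t[) (s * u `^ (s - 1))%:E = (t `^ s)%:E.
Proof.
move=> s0 t0.
(* The shift by 2 keeps [a n < t] strict already at [n = 0]. *)
pose a n : R := (t / n.+2%:R)%R.
have a0 n : (0 < a n)%R by rewrite divr_gt0.
have a_lt n : (a n < t)%R.
  by rewrite ltr_pdivrMr// ltr_pMr// ltr1n.
have acvg : a n @[n --> \oo] --> (0 : R)%R.
  rewrite -(mulr0 t); apply: cvgM; first exact: cvg_cst.
  by rewrite (cvg_shiftS (fun n : nat => n.+1%:R^-1 : R)%R); exact: cvg_harmonic.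
have an n : \int[mu]_(u in `[a n, t]) (s * u `^ (s - 1))%:E
    = (t `^ s - a n `^ s)%:E.
  have pos u : (a n <= u)%R -> (0 < u)%R by exact: lt_le_trans.
  rewrite (@continuous_FTC2 _ _ (fun u => u `^ s)%R)//.
  - apply: continuous_in_subspaceT => u /set_mem/=; rewrite in_itv/= => /andP[au _].
    apply: cvgM; first exact: cvg_cst.
    by apply: continuous_powR; exact: pos.
  - split.
    + move=> u; rewrite in_itv/= => /andP[au _].
      by apply: derivable_powR; rewrite in_itv/= (pos _ (ltW au)).
    + by apply: cvg_at_right_filter; exact: continuous_powR.
    + by apply: cvg_at_left_filter; exact: continuous_powR.
  - move=> u; rewrite in_itv/= => /andP[au _].
    by apply: powR_derive1; rewrite in_itv/= (pos _ (ltW au)).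
have cup : `]0%R, t]%classic = \bigcup_n `[a n, t]%classic.
  apply/seteqP; split => u /=; rewrite in_itv/=.
    move=> /andP[u0 ut].
    have [N _ NP] : \forall n \near \oo, (a n < u)%R by exact: cvgr_lt acvg _ u0.
    by exists N => //=; rewrite in_itv/= ut ltW//; exact: NP (leqnn _).
  by move=> [n _] /=; rewrite !in_itv/= => /andP[au ->]; rewrite (lt_le_trans (a0 n)).
have mf : measurable_fun setT (fun u : R => (s * u `^ (s - 1))%:E).
  by apply/measurable_EFinP; apply: measurable_funM => //.
(* Adding the null endpoint [t] turns the domain into the union of the intervals [[a n, t]]. *)
rewrite integral_itv_bndo_bndc ?cup; last exact: measurable_funTS.
have powa : (a n `^ s)%R @[n --> \oo] --> (0 : R)%R.
  by have /cvg_at_rightP := powR_cvg0 s0; apply; split.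
have icvg : \int[mu]_(u in `[a n, t]) (s * u `^ (s - 1))%:E @[n --> \oo] -->
    \int[mu]_(u in \bigcup_n `[a n, t]%classic) (s * u `^ (s - 1))%:E.
  apply: ge0_nondecreasing_set_cvg_integral => //.
  - apply/nondecreasing_seqP => n; rewrite subsetEset => u /=; rewrite !in_itv/=.
    move=> /andP[au ->]; rewrite andbT (le_trans _ au)//.
    by rewrite ler_pM2l// lef_pV2 ?posrE// ler_nat.
  - by move=> n; exact: measurable_funTS.
  - by move=> n u _; rewrite lee_fin mulr_ge0 ?powR_ge0// ltW.
rewrite -(cvg_lim _ icvg)//; apply/cvg_lim => //.
under eq_fun do rewrite an.
apply: cvg_EFin; first exact: nearW.
rewrite -[X in _ --> X]subr0.
by apply: cvgB => //; exact: cvg_cst.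
Qed.
End integration.

(** * The Gamma function: functional equation and finiteness *)

Section gamma.
Context {R : realType}.
Local Notation mu := (@lebesgue_measure R).
Local Notation Rpos := (`]0%R, +oo[%classic : set R).
Local Open Scope ereal_scope.

(** The formula [x * |x| ^ -2] reduces this to measurability of powers, and it agrees with the
    convention that the inverse of 0 is 0. *)
Lemma measurable_invr : measurable_fun setT (@GRing.inv R).
Proof.
rewrite (_ : @GRing.inv R = fun x => (x * `|x| `^ (- 2%:R))%R).
  apply: measurable_funM => //.
  by apply: (measurableT_comp (measurable_powR _)); exact: normr_measurable.
apply/funext => x; rewrite powR_invn// real_normK ?num_real//.
have [->|x0] := eqVneq x 0%R; first by rewrite invr0 mul0r.
by field.
Qed.

(** This serves to read off the slices of the region [0 < u < t] in the proof of [eGammaS]. *)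
Lemma integral_if (D E : set R) (b : pred R) (f : R -> R) :
  (forall x, E x <-> D x /\ b x) ->
  \int[mu]_(x in D) (if b x then f x else 0%R)%:E = \int[mu]_(x in E) (f x)%:E.
Proof.
move=> EDb; rewrite [LHS]integral_mkcond [RHS]integral_mkcond.
apply: eq_integral => x _; rewrite !patchE.
case: ifPn => xD.
  case: ifPn => xb; case: ifPn => xE//.
  - by move: xE; rewrite notin_setE => -[]; apply/EDb; split => //; exact: set_mem.
  - by move: xE => /set_mem/EDb[_]; rewrite (negbTE xb).
case: ifPn => // /set_mem/EDb[/mem_set].
by rewrite (negbTE xD).
Qed.

(** Extended real values let Tonelli and the functional equation be stated before finiteness is
    known. *)
Definition eGamma (s : R) : \bar R :=
  \int[mu]_(t in `]0%R, +oo[) (t `^ (s - 1) * expR (- t))%:E.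

Lemma measurable_expRN (D : set R) : measurable_fun D (fun t : R => expR (- t)).
Proof. by apply: measurable_funTS; apply: measurableT_comp. Qed.

Lemma eGamma_ge0 (s : R) : 0 <= eGamma s.
Proof.
by apply: integral_ge0 => t _; rewrite lee_fin mulr_ge0 ?powR_ge0 ?expR_ge0.
Qed.

(* Both sides are the integral of [s * u `^ (s - 1) * expR (- t)] over the
   region [0 < u < t]. *)
Lemma eGammaS (s : R) : (0 < s)%R -> eGamma (s + 1) = s%:E * eGamma s.
Proof.
move=> s0.
pose f (t u : R) : R := if (u < t)%R then (s * u `^ (s - 1) * expR (- t))%R else 0%R.
have m1 : measurable_fun setT (fun z : R * R => f z.1 z.2).
  apply: measurable_fun_ifT => //.
    exact: measurable_fun_ltr.
  apply: measurable_funM => //; last first.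
    exact: (measurableT_comp (measurable_expRN setT)).
  apply: measurable_funM => //.
  exact: (measurableT_comp (measurable_powR _)).
have spos (u : R) : (0 <= s * u `^ (s - 1))%R by rewrite mulr_ge0 ?powR_ge0// ltW.
transitivity (\int[mu]_(t in Rpos) \int[mu]_(u in Rpos) (f t u)%:E).
  apply: eq_integral => t /set_mem/=; rewrite in_itv/= andbT => t0.
  rewrite (@integral_if _ `]0%R, t[%classic); last first.
    by move=> u /=; rewrite !in_itv/= andbT; split => [/andP[]//|[-> ->]].
  under eq_integral do rewrite mulrC EFinM.
  rewrite ge0_integralZl//=.
  - by rewrite integral_powR// addrK EFinM muleC.
  - by apply/measurable_EFinP; apply: measurable_funTS; apply: measurable_funM.
  - by move=> u _; rewrite lee_fin.
rewrite tonelli_setX//; last 2 first.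
- exact: measurable_funTS.
- by move=> t u _ _; rewrite /f; case: ifP => // _; rewrite mulr_ge0 ?expR_ge0.
rewrite /eGamma -ge0_integralZl//=; last 3 first.
- apply/measurable_EFinP; apply: measurable_funM => //; last exact: measurable_expRN.
  exact: measurable_funTS.
- by move=> t _; rewrite lee_fin mulr_ge0 ?powR_ge0 ?expR_ge0.
- by rewrite lee_fin ltW.
apply: eq_integral => u /set_mem/=; rewrite in_itv/= andbT => u0.
rewrite (@integral_if _ `]u, +oo[%classic); last first.
  move=> t /=; rewrite !in_itv/= !andbT; split => [ut|[]//].
  by split => //; exact: lt_trans ut.
under eq_integral do rewrite EFinM.
rewrite ge0_integralZl//=; last 2 first.
- by apply/measurable_EFinP; exact: measurable_expRN.
- by rewrite lee_fin.
have := @integral_expRNM R 1 u ltr01.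
under eq_integral do rewrite !mul1r.
by move=> ->; rewrite mul1r -!EFinM mulrA.
Qed.

(* [t `^ s <= (2 * s) `^ s * expR (t / 2)], from [1 + y <= expR y]
   at [y = t / (2 * s)]. *)
Lemma eGamma_lty (s : R) : (0 < s)%R -> eGamma s < +oo.
Proof.
(* At [s + 1] the power in the integrand is [t ^ s], with positive exponent, hence bounded near 0.
   The functional equation carries finiteness back, since [s * +oo] is [+oo]. *)
move=> s0; suff : eGamma (s + 1) < +oo.
  rewrite eGammaS//; have := eGamma_ge0 s.
  by case: (eGamma s) => [r| |]//= _; rewrite ?ltry// gt0_muley.
have s2 : (0 < 2 * s)%R by lra.
(* The last factor 2 cancels the [2^-1] that [integral_expRNM] requires in front of the
   exponential. *)
pose C := ((2 * s) `^ s * 2)%R.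
apply: (@le_lt_trans _ _ (\int[mu]_(t in Rpos)
    (C%:E * (2^-1 * expR (- (2^-1 * t)))%:E))).
  apply: ge0_le_integral => //.
  - by move=> t _; rewrite lee_fin mulr_ge0 ?powR_ge0 ?expR_ge0.
  - apply/measurable_EFinP; apply: measurable_funM => //; last exact: measurable_expRN.
    exact: measurable_funTS.
  - apply/measurable_EFinP; apply: measurable_funTS.
    apply: measurable_funM => //; apply: measurable_funM => //.
    by apply: (measurableT_comp (measurable_expRN setT)); exact: measurable_funM.
  - move=> t /=; rewrite in_itv/= andbT => t0.
    rewrite addrK lee_fin /C -!mulrA mulVKf ?pnatr_eq0//.
    rewrite [X in (_ <= _ * X)%R](_ : _ = expR (2^-1 * t) * expR (- t))%R; last first.
      by rewrite -expRD; congr expR; lra.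
    rewrite mulrA ler_wpM2r ?expR_ge0//.
    (* Both sides become powers with exponent [s], so it suffices to compare the bases. *)
    have -> : (2^-1 * t = t / (2 * s) * s)%R by field; rewrite gt_eqF.
    rewrite expRM -powRM ?expR_ge0//; last exact: ltW.
    rewrite ge0_ler_powR ?nnegrE ?mulr_ge0 ?expR_ge0//; try exact: ltW.
    rewrite mulrC -ler_pdivrMr//.
    by rewrite (le_trans _ (expR_ge1Dx _))// lerDr.
rewrite ge0_integralZl//=.
- by rewrite integral_expRNM ?invr_gt0// -EFinM ltry.
- apply/measurable_EFinP; apply: measurable_funTS; apply: measurable_funM => //.
  by apply: (measurableT_comp (measurable_expRN setT)); exact: measurable_funM.
- by rewrite lee_fin mulr_ge0 ?powR_ge0.
Qed.

(** [Rintegral] goes through [fine], which would send an infinite integral to 0; [eGamma_lty]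
    excludes that. *)
Lemma EFin_Gamma (s : R) : (0 < s)%R -> (Gamma s)%:E = eGamma s.
Proof.
move=> s0; rewrite /Gamma /Rintegral fineK//.
by rewrite ge0_fin_numE ?eGamma_ge0// eGamma_lty.
Qed.

End gamma.

(** * Measurability, finiteness and moments of [rho] *)

Section rho_moments.
Context {R : realType}.
Local Notation mu := (@lebesgue_measure R).
Local Notation Rpos := (`]0%R, +oo[%classic : set R).
Local Open Scope ereal_scope.

(** Scaling by [t] turns the exponential into [expR (- x)]; the Jacobian [t] and the factor
    [t ^ (s - 1)] combine to [t ^ s]. *)
Lemma integral_powR_expRN_div (s t : R) : (0 < t)%R ->
  \int[mu]_(x in `]0%R, +oo[) (x `^ (s - 1) * expR (- (x / t)))%:E =
  (t `^ s)%:E * eGamma s.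
Proof.
move=> t0; rewrite (ge0_integral_scale _ _ t0); last 2 first.
- apply: measurable_funM => //.
  by apply: (measurableT_comp (measurable_expRN setT)); exact: measurable_funM.
- by move=> x _; rewrite mulr_ge0 ?powR_ge0 ?expR_ge0.
have -> : (t `^ s)%:E = t%:E * (t `^ (s - 1))%:E.
  rewrite -EFinM -{2}(powRr1 (ltW t0)) -powRD; last by rewrite (gt_eqF t0) ?implybT.
  by rewrite addrC subrK.
rewrite -muleA; congr (_ * _).
rewrite -ge0_integralZl//=; last 3 first.
- apply/measurable_EFinP; apply: measurable_funM => //; last exact: measurable_expRN.
  exact: measurable_funTS.
- by move=> x _; rewrite lee_fin mulr_ge0 ?powR_ge0 ?expR_ge0.
- by rewrite lee_fin powR_ge0.
apply: eq_integral => x /set_mem/=; rewrite in_itv/= andbT => x0.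
rewrite -EFinM powRM ?ltW// mulrA; congr (_ * expR (- _))%:E.
by rewrite mulrC mulKf// gt_eqF.
Qed.

Definition rho_kernel (nu x t : R) : R := (t `^ (nu - 1) * expR (- t - x / t))%R.

Lemma rho_kernel_ge0 (nu x t : R) : (0 <= rho_kernel nu x t)%R.
Proof. by rewrite mulr_ge0 ?powR_ge0 ?expR_ge0. Qed.

Lemma measurable_rho_kernel (nu : R) :
  measurable_fun setT (fun z : R * R => rho_kernel nu z.1 z.2).
Proof.
apply: measurable_funM; first exact: (measurableT_comp (measurable_powR _)).
apply: measurableT_comp => //; apply: measurable_funB.
  exact: measurableT_comp.
by apply: measurable_funM => //; exact: (measurableT_comp measurable_invr).
Qed.

(** The partial integral of a nonnegative jointly measurable function is measurable with extended
    values, and [fine] preserves this. *)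
Lemma measurable_rho (nu : R) : measurable_fun setT (rho nu).
Proof.
pose D := (setT : set R) `*` Rpos.
have mD : measurable D by exact: measurableX.
pose g := (fun z : R * R => (rho_kernel nu z.1 z.2)%:E) \_ D.
have mg : measurable_fun setT g.
  apply/(measurable_restrictT _ mD); apply/measurable_EFinP.
  by apply: measurable_funTS; exact: measurable_rho_kernel.
have g0 z : 0 <= g z.
  by rewrite /g patchE; case: ifPn => // _; rewrite lee_fin rho_kernel_ge0.
rewrite (_ : rho nu = fine \o (fun x => \int[mu]_t g (x, t))).
  apply: measurableT_comp => //.
  exact: (@measurable_fun_fubini_tonelli_F _ _ (measurableTypeR R) (measurableTypeR R) R mu g mg g0).
apply/funext => x; rewrite /rho /Rintegral/= integral_mkcond; congr fine.
apply: eq_integral => t _; rewrite /g !patchE /D/= in_setX/= in_setT/=.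
by case: ifP.
Qed.

(* [expR (- (x / t)) <= t / x] removes the singularity of the kernel at
   [t = 0]. *)
Lemma EFin_rho (nu x : R) : (0 <= nu)%R -> (0 < x)%R ->
  (rho nu x)%:E = \int[mu]_(t in `]0%R, +oo[) (rho_kernel nu x t)%:E.
Proof.
move=> nu0 x0; rewrite /rho /Rintegral fineK// ge0_fin_numE; last first.
  by apply: integral_ge0 => t _; rewrite lee_fin rho_kernel_ge0.
have mk (p : R) : measurable_fun Rpos (fun t => t `^ p * expR (- t))%R.
  by apply: measurable_funM => //; [exact: measurable_funTS|exact: measurable_expRN].
(* The dominating function is [x^-1] times the integrand of [eGamma (nu + 1)], which is finite even
   at [nu = 0]. *)
apply: (@le_lt_trans _ _ (\int[mu]_(t in Rpos)
    (x^-1%:E * (t `^ (nu + 1 - 1) * expR (- t))%:E))).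
  apply: ge0_le_integral => //.
  - by move=> t _; rewrite lee_fin rho_kernel_ge0.
  - apply/measurable_EFinP; apply: measurable_funTS.
    exact: (measurableT_comp (measurable_rho_kernel nu) (measurable_pair1 x)).
  - by apply/measurable_EFinP; apply: measurable_funM => //; exact: mk.
  - move=> t /=; rewrite in_itv/= andbT => t0.
    rewrite -EFinM lee_fin expRD.
    rewrite [leRHS](_ : _ = t `^ (nu - 1) * (expR (- t) * (t / x)))%R.
      rewrite ler_wpM2l ?powR_ge0// ler_wpM2l ?expR_ge0//.
      rewrite expRN -[leRHS]invf_div lef_pV2 ?posrE ?expR_gt0 ?divr_gt0//.
      by rewrite (le_trans _ (expR_ge1Dx _))// lerDr.
    rewrite addrK -(subrK 1%R nu) [in LHS]powRD ?(gt_eqF t0) ?implybT//.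
    by rewrite powRr1 ?ltW// subrK; ring.
rewrite ge0_integralZl//=.
- have nu1 : (0 < nu + 1)%R by lra.
  rewrite -/(eGamma (nu + 1)).
  have := eGamma_lty _ nu1; have := eGamma_ge0 (nu + 1).
  by case: (eGamma (nu + 1)) => [r| |]//= _ _; rewrite -EFinM ltry.
- by apply/measurable_EFinP; exact: mk.
- by move=> t _; rewrite lee_fin mulr_ge0 ?powR_ge0 ?expR_ge0.
- by rewrite lee_fin invr_ge0 ltW.
Qed.

Lemma rho_ge0 (nu x : R) : (0 <= rho nu x)%R.
Proof. by apply: Rintegral_ge0 => t _; exact: rho_kernel_ge0. Qed.

(** After exchanging the integrals, the one over [x] yields [t ^ s * eGamma s], and what remains in
    [t] is the integrand of [eGamma (nu + s)]. *)
Lemma integral_powR_rho (nu s : R) : (0 <= nu)%R ->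
  \int[mu]_(x in `]0%R, +oo[) (x `^ (s - 1) * rho nu x)%:E =
  eGamma s * eGamma (nu + s).
Proof.
move=> nu0.
transitivity (\int[mu]_(x in Rpos) \int[mu]_(t in Rpos)
    (x `^ (s - 1) * rho_kernel nu x t)%:E).
  apply: eq_integral => x /set_mem/=; rewrite in_itv/= andbT => x0.
  rewrite EFinM EFin_rho// -ge0_integralZl//=.
  - apply/measurable_EFinP; apply: measurable_funTS.
    exact: (measurableT_comp (measurable_rho_kernel nu) (measurable_pair1 x)).
  - by move=> t _; rewrite lee_fin rho_kernel_ge0.
  - by rewrite lee_fin powR_ge0.
rewrite tonelli_setX//; last 2 first.
- apply: measurable_funTS; apply: measurable_funM; last exact: measurable_rho_kernel.
  exact: (measurableT_comp (measurable_powR _)).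
- by move=> x t _ _; rewrite mulr_ge0 ?powR_ge0 ?rho_kernel_ge0.
rewrite [X in _ * X]/eGamma -ge0_integralZl//=; last 3 first.
- apply/measurable_EFinP; apply: measurable_funM => //; last exact: measurable_expRN.
  exact: measurable_funTS.
- by move=> t _; rewrite lee_fin mulr_ge0 ?powR_ge0 ?expR_ge0.
- exact: eGamma_ge0.
apply: eq_integral => t /set_mem/=; rewrite in_itv/= andbT => t0.
(* Splitting off [t ^ s] prepares the use of [integral_powR_expRN_div] backwards. *)
rewrite (_ : nu + s - 1 = nu - 1 + s)%R; last by ring.
rewrite powRD ?(gt_eqF t0) ?implybT// muleC -[X in X%:E * _]mulrA.
rewrite [X in X%:E * _](_ : _ = t `^ (nu - 1) * expR (- t) * t `^ s)%R; last by ring.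
rewrite EFinM -muleA -integral_powR_expRN_div// -ge0_integralZl//=; last 3 first.
- apply/measurable_EFinP; apply: measurable_funTS; apply: measurable_funM => //.
  by apply: (measurableT_comp (measurable_expRN setT)); exact: measurable_funM.
- by move=> x _; rewrite lee_fin mulr_ge0 ?powR_ge0 ?expR_ge0.
- by rewrite lee_fin mulr_ge0 ?powR_ge0 ?expR_ge0.
apply: eq_integral => x _; rewrite -EFinM /rho_kernel expRD; congr (_%:E).
by ring.
Qed.

End rho_moments.

(** * Action of [theta] and its polynomials on powers *)

Section theta_powers.
Context {R : realType}.

(** The rising factorial, or Pochhammer symbol, [(x)_k]. *)
Definition rfac (x : R) (k : nat) : R := \prod_(j < k) (x + j%:R).

Lemma rfacS (x : R) (k : nat) : rfac x k.+1 = rfac x k * (x + k%:R).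
Proof. exact: big_ord_recr. Qed.

Lemma rfacD (x : R) (i k : nat) : rfac x (i + k) = rfac x i * rfac (x + i%:R) k.
Proof.
rewrite /rfac big_split_ord/=; congr (_ * _).
by apply: eq_bigr => j _; rewrite natrD addrA.
Qed.

Lemma eGamma_rfac (x : R) (k : nat) : 0 < x ->
  eGamma (x + k%:R) = ((rfac x k)%:E * eGamma x)%E.
Proof.
move=> x0; elim: k => [|k IH]; first by rewrite addr0 /rfac big_ord0 mul1e.
rewrite -natr1 addrA eGammaS ?ltr_wpDr// IH rfacS muleA -EFinM.
by rewrite (mulrC (x + _)).
Qed.

(** Differentiation is local and the half-line is open. This lets formulas known only for positive
    arguments be fed back into [theta]. *)
Lemma theta_ext (f g : R -> R) (t : R) : (forall s, 0 < s -> f s = g s) ->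
  0 < t -> theta f t = theta g t.
Proof.
move=> fg t0; rewrite /theta !derive1E; congr (_ * _).
apply: near_eq_derive.
near=> s; rewrite fg//; near: s; exact: lt_nbhsr.
Unshelve. all: by end_near. Qed.

(** Finite sums of real powers form a class stable under [theta] whose terms are derivable on the
    half-line, so that the derivative may be taken termwise. *)
Lemma theta_sum_powR (n : nat) (c b : 'I_n -> R) (t : R) : 0 < t ->
  theta (fun s => \sum_(i < n) c i * s `^ b i) t =
  \sum_(i < n) c i * (1 + b i) * t `^ (b i + 1).
Proof.
move=> t0.
rewrite /theta derive1E.
pose h (i : 'I_n) (s : R) : R := c i * s `^ (b i + 1).
rewrite (@near_eq_derive _ _ _ _ (\sum_(i < n) h i)); last first.
  near=> s; have s0 : 0 < s by near: s; exact: lt_nbhsr.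
  rewrite fct_sumE mulr_sumr; apply: eq_bigr => i _.
  rewrite /h powRD ?(gt_eqF s0) ?implybT// powRr1 ?ltW//; ring.
have dp (i : 'I_n) : derivable (@powR R ^~ (b i + 1)) t 1.
  by apply: derivable_powR; rewrite in_itv/= t0.
have dh (i : 'I_n) : derivable (h i) t 1 by exact: derivableM.
rewrite derive_sum// mulr_sumr; apply: eq_bigr => i _.
rewrite deriveM// derive_cst scaler0 addr0 -derive1E powR_derive1 ?in_itv/= ?t0//.
rewrite addrK powRD ?(gt_eqF t0) ?implybT// powRr1 ?ltW// /GRing.scale/=; ring.
Unshelve. all: by end_near. Qed.

Lemma iter_theta_sum_powR (n : nat) (c b : 'I_n -> R) (f : R -> R) (k : nat) :
  (forall t, 0 < t -> f t = \sum_(i < n) c i * t `^ b i) ->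
  forall t, 0 < t ->
  iter k (@theta R) f t = \sum_(i < n) c i * rfac (1 + b i) k * t `^ (b i + k%:R).
Proof.
move=> fE; elim: k => [|k IH] t t0.
  by rewrite /= fE//; apply: eq_bigr => i _; rewrite /rfac big_ord0 mulr1 addr0.
rewrite iterS (theta_ext _ _ _ IH t0) theta_sum_powR//.
apply: eq_bigr => i _; rewrite rfacS -natr1 !addrA; ring.
Qed.

(** The inner operator gives a sum of powers [a + i] with factors [rfac (1 + a) i]. The outer one
    contributes [rfac (1 + a + i) j], and [rfacD] merges the two. *)
Lemma polyop_polyop_powR (a : R) (p q : {poly R}) (t : R) : 0 < t ->
  polyop p (polyop q (fun s => s `^ a)) t =
  \sum_(j < size p) \sum_(i < size q)
    p`_j * q`_i * rfac (1 + a) (i + j) * t `^ (a + (i + j)%:R).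
Proof.
move=> t0; rewrite /polyop; apply: eq_bigr => j _.
rewrite (iter_theta_sum_powR (size q)
  (fun i => q`_i * rfac (1 + a) i) (fun i => a + i%:R))//.
  rewrite mulr_sumr; apply: eq_bigr => i _.
  by rewrite rfacD natrD !addrA; ring.
move=> {}t {}t0; apply: eq_bigr => i _.
rewrite (iter_theta_sum_powR 1 (fun=> 1) (fun=> a))//; last first.
  by move=> s _; rewrite big_ord1 mul1r.
by rewrite big_ord1; ring.
Qed.

End theta_powers.

(** * Comparison of the two bilinear forms *)

Section bilinear_forms.
Context {R : realType}.
Local Notation mu := (@lebesgue_measure R).
Local Notation Rpos := (`]0%R, +oo[%classic : set R).

(** On []0, 1[] the exponential is at least [expR (- 1)], and [s * t ^ (s - 1)] integrates to 1
    there; hence [s * Gamma s >= expR (- 1)]. *)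
Lemma Gamma_gt0 (s : R) : 0 < s -> 0 < Gamma s.
Proof.
move=> s0.
suff : (0 < s%:E * eGamma s)%E.
  by rewrite -EFin_Gamma// -EFinM lte_fin pmulr_rgt0.
rewrite /eGamma -ge0_integralZl//=; last 3 first.
- apply/measurable_EFinP; apply: measurable_funM; last exact: measurable_expRN.
  exact: measurable_funTS.
- by move=> t _; rewrite lee_fin mulr_ge0 ?powR_ge0 ?expR_ge0.
- by rewrite lee_fin ltW.
apply: (@lt_le_trans _ _ (expR (- 1))%:E); first by rewrite lte_fin expR_gt0.
apply: (@le_trans _ _ (\int[mu]_(t in `]0%R, 1%R[)
    (s%:E * (t `^ (s - 1) * expR (- t))%:E))%E); last first.
  apply: ge0_subset_integral => //.
  - apply/measurable_EFinP; apply: measurable_funM => //.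
    apply: measurable_funM; last exact: measurable_expRN.
    exact: measurable_funTS.
  - by move=> t _; rewrite lee_fin !mulr_ge0 ?powR_ge0 ?expR_ge0 ?ltW.
  - by move=> t /=; rewrite !in_itv/= => /andP[->].
have -> : ((expR (- 1))%:E = (expR (- 1))%:E * (1 `^ s)%:E :> \bar R)%E.
  by rewrite -EFinM powR1 mulr1.
rewrite -integral_powR// -ge0_integralZl//=; last 2 first.
- by apply/measurable_EFinP; apply: measurable_funM => //; exact: measurable_funTS.
- by move=> t _; rewrite lee_fin mulr_ge0 ?powR_ge0 ?ltW.
apply: ge0_le_integral => //.
- by move=> t _; rewrite lee_fin !mulr_ge0 ?powR_ge0 ?expR_ge0 ?ltW.
- apply/measurable_EFinP; apply: measurable_funM => //.
  by apply: measurable_funM => //; exact: measurable_funTS.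
- apply/measurable_EFinP; apply: measurable_funM => //.
  apply: measurable_funM; last exact: measurable_expRN.
  exact: measurable_funTS.
- move=> t /=; rewrite in_itv/= => /andP[t0 t1].
  rewrite -!EFinM lee_fin mulrC -mulrA ler_wpM2l//; first exact: ltW.
  rewrite ler_wpM2l ?powR_ge0//.
  by rewrite ler_expR lerN2 ltW.
Qed.

(** The coefficients may have any sign, so linearity rests on integrability, which the finite
    integrals [M k] of the nonnegative [g k] supply. Both forms are of this shape, with moments
    depending only on [i + j]. *)
Lemma integral_double_sum (D : set R) (g : nat -> R -> R) (M : nat -> R)
    (m n : nat) (c : 'I_m -> 'I_n -> R) :
  measurable D -> (forall k, measurable_fun D (g k)) ->
  (forall k x, D x -> 0 <= g k x) ->
  (forall k, (\int[mu]_(x in D) (g k x)%:E = (M k)%:E)%E) ->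
  (\int[mu]_(x in D) (\sum_(j < m) \sum_(i < n) c j i * g (i + j)%N x)%:E =
  (\sum_(j < m) \sum_(i < n) c j i * M (i + j)%N)%:E)%E.
Proof.
move=> mD mg g0 gM.
have ig k : mu.-integrable D (EFin \o g k).
  apply/integrableP; split; first by apply/measurable_EFinP; exact: mg.
  under eq_integral => x /set_mem Dx do rewrite /= ger0_norm ?g0//.
  by rewrite gM ltry.
have igc (j : 'I_m) (i : 'I_n) :
    mu.-integrable D (fun x => (c j i)%:E * (g (i + j)%N x)%:E)%E.
  exact: (@integrableZl _ (measurableTypeR R) R mu D mD (c j i) _ (ig (i + j)%N)).
under eq_integral => x _.
  rewrite -sumEFin; under eq_bigr do rewrite -sumEFin.
  under eq_bigr do under eq_bigr do rewrite EFinM.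
  over.
rewrite integral_sum//=; last by move=> j; exact: integrable_sum.
rewrite -sumEFin; apply: eq_bigr => j _.
rewrite integral_sum//= -sumEFin; apply: eq_bigr => i _.
by rewrite integralZl ?gM// ig.
Qed.

Lemma integral_polyop (nu a : R) (p q : {poly R}) : 0 <= nu -> - 1 < a ->
  (\int[mu]_(t in `]0%R, +oo[)
     (t `^ nu * expR (- t) * polyop p (polyop q (fun s => s `^ a)) t)%:E =
  (\sum_(j < size p) \sum_(i < size q) p`_j * q`_i * rfac (1 + a) (i + j)
     * Gamma (nu + a + 1 + (i + j)%:R))%:E)%E.
Proof.
move=> nu0 a1.
rewrite -(@integral_double_sum Rpos
  (fun k t => t `^ (nu + a + 1 + k%:R - 1) * expR (- t))
  (fun k => Gamma (nu + a + 1 + k%:R))) //.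
- apply: eq_integral => t /set_mem/=; rewrite in_itv/= andbT => t0.
  rewrite polyop_polyop_powR// mulr_sumr; congr (_%:E); apply: eq_bigr => j _.
  rewrite mulr_sumr; apply: eq_bigr => i _.
  rewrite [nu + a + 1 + _ - 1](_ : _ = nu + (a + (i + j)%:R)); last by ring.
  by rewrite [in RHS]powRD ?(gt_eqF t0) ?implybT//; ring.
- move=> k; apply: measurable_funM; last exact: measurable_expRN.
  exact: measurable_funTS.
- by move=> k t _; rewrite mulr_ge0 ?powR_ge0 ?expR_ge0.
- move=> k; rewrite EFin_Gamma//.
  by rewrite ltr_wpDr//; lra.
Qed.

(** The moments are compared term by term: in [Gamma (1 + a + k) * Gamma (nu + a + 1 + k)] the first
    factor is [rfac (1 + a) k * Gamma (1 + a)], and the [rfac] is the one produced by [theta]. *)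
Lemma integral_poly_rho (nu a : R) (p q : {poly R}) : 0 <= nu -> - 1 < a ->
  (\int[mu]_(x in `]0%R, +oo[) (p.[x] * q.[x] * x `^ a * rho nu x)%:E =
  (Gamma (1 + a))%:E * \int[mu]_(t in `]0%R, +oo[)
     (t `^ nu * expR (- t) * polyop p (polyop q (fun s => s `^ a)) t)%:E)%E.
Proof.
move=> nu0 a1; have a0 : 0 < 1 + a by lra.
rewrite integral_polyop// -EFinM.
transitivity (\sum_(j < size p) \sum_(i < size q) p`_j * q`_i *
  (rfac (1 + a) (i + j) * Gamma (1 + a) * Gamma (nu + a + 1 + (i + j)%:R)))%:E; last first.
  rewrite mulr_sumr; congr (_%:E); apply: eq_bigr => j _.
  by rewrite mulr_sumr; apply: eq_bigr => i _; ring.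
rewrite -(@integral_double_sum Rpos
  (fun k x => x `^ (1 + a + k%:R - 1) * rho nu x)
  (fun k => rfac (1 + a) k * Gamma (1 + a) * Gamma (nu + a + 1 + k%:R))) //.
- apply: eq_integral => x /set_mem/=; rewrite in_itv/= andbT => x0.
  rewrite !horner_coef mulr_suml !mulr_suml; congr (_%:E); apply: eq_bigr => j _.
  rewrite mulr_sumr !mulr_suml; apply: eq_bigr => i _.
  rewrite [1 + a + _ - 1](_ : _ = a + i%:R + j%:R); last by rewrite natrD; ring.
  by rewrite !powRD ?(gt_eqF x0) ?implybT// !powR_mulrn ?ltW//; ring.
- move=> k; apply: measurable_funM; apply: measurable_funTS => //.
  exact: measurable_rho.
- by move=> k x _; rewrite mulr_ge0 ?powR_ge0 ?rho_ge0.
- move=> k; rewrite integral_powR_rho// eGamma_rfac// !EFinM !EFin_Gamma//.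
    by congr (_ * _ * eGamma _)%E; ring.
  by rewrite ltr_wpDr//; lra.
Qed.

End bilinear_forms.

Theorem theorem1 (R : realType) (nu alpha : R) (P : nat -> {poly R}) :
  0 <= nu -> -1 < alpha ->
  (forall n m : nat,
     (\int[@lebesgue_measure R]_(x in `]0%R, +oo[)
        ((P n).[x] * (P m).[x] * x `^ alpha * rho nu x)%:E)%E
     = ((n == m)%:R)%:E)
  <->
  (forall m n : nat,
     (\int[@lebesgue_measure R]_(t in `]0%R, +oo[)
        (t `^ nu * expR (- t)
         * polyop (P m) (polyop (P n) (fun s : R => s `^ alpha)) t)%:E)%E
     = ((m == n)%:R / Gamma (1 + alpha))%:E).
Proof.
move=> nu0 a1; have G0 : 0 < Gamma (1 + alpha) by apply: Gamma_gt0; lra.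
(* In both directions the first index is that of the outer operator. [integral_polyop] exhibits the
   integral as a real number, so the positive constant [Gamma (1 + alpha)] can be cancelled in
   [R]. *)
split=> PP m n; have := PP m n; rewrite integral_poly_rho// integral_polyop//.
  rewrite -EFinM => -[<-]; congr (_%:E).
  by rewrite mulrC mulKf// gt_eqF.
by move=> -[->]; rewrite -EFinM mulrC divfK// gt_eqF.
Qed.
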